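(* Let $\mathbf{g}=(E,V,r,s)$ be a directed graph such that $r$ is onto and $s^{-1}(v)$ is nonempty and finite for every $v\in V$, and let $\Gamma=\Gamma(\mathbf{g})$. The map $I\mapsto\{r(p):p\in I,\ p\neq0\}$ is an isomorphism between the lattice of (nonempty) invariant $<$-closed subsets of $\Gamma^{(0)}$ and the lattice of hereditary saturated subsets of $V$. The inverse is given by $H\mapsto\{p\in\Gamma^{(0)}\setminus\{0\}:r(p)\in H\}\cup\{0\}$.
   Context: Graph: $E$ edges, $V$ vertices, $r,s:E\to V$ range and source. A path of length $n\ge1$ is $\alpha=(\alpha_1,\ldots,\alpha_n)\in E^n$ with $s(\alpha_{j+1})=r(\alpha_j)$; $s(\alpha)=s(\alpha_1)$, $r(\alpha)=r(\alpha_n)$. Paths of length $0$ are vertices $v$ with $r(v)=s(v)=v$. $F(\mathbf{g})$ is the set of finite paths (including length $0$); $\alpha\mu$ is concatenation, defined if $r(\alpha)=s(\mu)$, length-$0$ paths acting as identities. $\Gamma(\mathbf{g})=\{(\alpha,\beta)\in F(\mathbf{g})\times F(\mathbf{g}):r(\alpha)=r(\beta)\}\cup\{0\}$ with $(\alpha,\beta)(\beta\mu,\delta)=(\alpha\mu,\delta)$, $(\alpha,\gamma\mu)(\gamma,\delta)=(\alpha,\delta\mu)$ ($\mu$ possibly of length $0$), all other products $0$; it is an inverse semigroup with zero and $(\alpha,\beta)^{-1}=(\beta,\alpha)$. Its nonzero idempotents are $p=(\alpha,\alpha)$, and $r(p)=r(\alpha)$. $\Gamma^{(0)}$ is the set of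 idempotents. In an inverse semigroup $x\prec y$ means $xy^{-1}=xx^{-1}$. For $n\ge1$ write $x<(x_1,\ldots,x_n)$ if for every $y\prec x$, $y\neq0$, there exist $z\ne0$ and $j$ with $z\prec y$ and $z\prec x_j$. A subset $I\subset\Gamma^{(0)}$ is $<$-closed if $p\in\Gamma^{(0)}$ belongs to $I$ whenever $p<(p_1,\ldots,p_n)$ for some $p_1,\ldots,p_n\in I$; it is invariant if $xpx^{-1}\in I$ for all $p\in I$, $x\in\Gamma$ with $p\prec x^{-1}x$. The nonempty $<$-closed invariant subsets form a lattice under inclusion with $I\wedge J=I\cap J$ and $I\vee J=\{p\in\Gamma^{(0)}:p<(p_1,\ldots,p_n),\ p_1,\ldots,p_n\in I\cup J\}$. For $v,w\in V$ write $v\ge w$ if there is a finite path from $v$ to $w$. $H\subset V$ is hereditary if $v\in H$ and $v\ge w$ imply $w\in H$; it is saturated if whenever $v\in V$ and $r(e)\in H$ for all $e\in E$ with $s(e)=v$, then $v\in H$. Hereditary saturated subsets form a lattice under intersection and union followed by saturation. *)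

(* Defs.v *)
From mathcomp Require Import all_boot.
From mathcomp Require Import boolp classical_sets cardinality.

Set Implicit Arguments.
Unset Strict Implicit.
Unset Printing Implicit Defensive.

Local Open Scope classical_set_scope.

Record digraph := Digraph {
  edge : Type;
  vertex : Type;
  rng : edge -> vertex;
  src : edge -> vertex
}.

Section Paths.
Variable g : digraph.

Fixpoint is_chain (v : vertex g) (l : seq (edge g)) : Prop :=
  if l is e :: l' then src e = v /\ is_chain (rng e) l' else True.

(* A finite path is recorded as its source together with its list of edges.
   The empty list at v is the path v of length 0; for a nonempty list the
   chain condition forces the source to be that of the first edge, so that
   paths of positive length are exactly the composable sequences of edges. *)
Record fpath := FPath {
  psrc : vertex g;
  pedges : seq (edge g);
  pchain : is_chain psrc pedges
}.

Definition prng (a : fpath) : vertex g :=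
  last (psrc a) [seq rng e | e <- pedges a].

Lemma fpath_eq (a b : fpath) :
  psrc a = psrc b -> pedges a = pedges b -> a = b.
Proof.
case: a b => [v l c] [w m d] /= vw lm; subst w m.
by rewrite (Prop_irrelevance c d).
Qed.

Lemma is_chain_cat v (l m : seq (edge g)) :
  is_chain v (l ++ m) <->
  is_chain v l /\ is_chain (last v [seq rng e | e <- l]) m.
Proof.
elim: l v => [|e l IH] v /=; first by split=> [|[]].
by rewrite IH; split=> [[? []]|[[]]].
Qed.

Definition pcat (a m : fpath) (am : prng a = psrc m) : fpath :=
  @FPath (psrc a) (pedges a ++ pedges m)
    (proj2 (is_chain_cat _ _ _)
       (conj (pchain a) (eq_ind_r (is_chain^~ (pedges m)) (pchain m) am))).

Lemma prng_pcat a m (am : prng a = psrc m) : prng (pcat am) = prng m.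
Proof. by rewrite /prng /= map_cat last_cat -am. Qed.

Inductive gamma :=
  | gzero
  | gpair (a b : fpath) of prng a = prng b.

(* The nonzero products: (a, b)(b m, d) = (a m, d) and
   (a, c m)(c, d) = (a, d m). *)
Inductive gmul_spec : gamma -> gamma -> gamma -> Prop :=
  | GmulL a b m d (ab : prng a = prng b) (bm : prng b = psrc m)
      (am : prng a = psrc m) (bmd : prng (pcat bm) = prng d)
      (amd : prng (pcat am) = prng d) :
      gmul_spec (gpair ab) (gpair bmd) (gpair amd)
  | GmulR a c m d (cm : prng c = psrc m) (acm : prng a = prng (pcat cm))
      (cd : prng c = prng d) (dm : prng d = psrc m)
      (adm : prng a = prng (pcat dm)) :
      gmul_spec (gpair acm) (gpair cd) (gpair adm).

Definition gmul (x y : gamma) : gamma :=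
  if pselect (exists z, gmul_spec x y z) is left xy then projT1 (cid xy)
  else gzero.

Definition ginv (x : gamma) : gamma :=
  if x is gpair a b ab then gpair (esym ab) else gzero.

Lemma gpair_eq a b a' b' (ab : prng a = prng b) (ab' : prng a' = prng b') :
  a = a' -> b = b' -> gpair ab = gpair ab'.
Proof. by move=> aa bb; subst a' b'; rewrite (Prop_irrelevance ab ab'). Qed.

Lemma gpair_inj a b a' b' (ab : prng a = prng b) (ab' : prng a' = prng b') :
  gpair ab = gpair ab' -> a = a' /\ b = b'.
Proof. by case. Qed.

Lemma gmul_spec_pair x y z : gmul_spec x y z ->
  exists a b c d (ab : prng a = prng b) (cd : prng c = prng d),
    [/\ x = gpair ab, y = gpair cd &
      (exists m (bm : prng b = psrc m) (am : prng a = psrc m) amd,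
         c = pcat bm /\ z = @gpair (pcat am) d amd)
      \/ (exists m (cm : prng c = psrc m) (dm : prng d = psrc m) adm,
         b = pcat cm /\ z = @gpair a (pcat dm) adm)].
Proof.
case=> [a b m d ab bm am bmd amd|a c m d cm acm cd dm adm].
- exists a, b, (pcat bm), d, ab, bmd; split=> //; left.
  by exists m, bm, am, amd.
- exists a, (pcat cm), c, d, acm, cd; split=> //; right.
  by exists m, cm, dm, adm.
Qed.

Lemma pcat_inj a m m' (am : prng a = psrc m) (am' : prng a = psrc m') :
  pcat am = pcat am' -> m = m'.
Proof.
move=> /(congr1 (drop (size (pedges a)) \o (@pedges))) /=.
by rewrite !drop_size_cat // => mm; apply: fpath_eq; rewrite // -am -am'.
Qed.

Lemma pcat_nil a m (am : prng a = psrc m) : pedges m = [::] -> pcat am = a.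
Proof. by move=> m0; apply: fpath_eq => //=; rewrite m0 cats0. Qed.

Lemma pcat_pcat_nil a m b m' (am : prng a = psrc m) (bm : prng b = psrc m') :
  b = pcat am -> a = pcat bm -> pedges m = [::] /\ pedges m' = [::].
Proof.
move=> /(congr1 (size \o pedges)) /= + /(congr1 (size \o pedges)) /=.
rewrite !size_cat => -> /eqP; rewrite -addnA -[X in X == _]addn0 eqn_add2l.
by rewrite eq_sym addn_eq0 => /andP[/eqP/size0nil-> /eqP/size0nil->].
Qed.

Lemma gmul_spec_fun x y z z' : gmul_spec x y z -> gmul_spec x y z' -> z = z'.
Proof.
move=> /gmul_spec_pair[a [b [c [d [ab [cd [-> -> H]]]]]]].
move=> /gmul_spec_pair[a' [b' [c' [d' [ab' [cd' [e1 e2 H']]]]]]].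
have [? ?] := gpair_inj e1; have [? ?] := gpair_inj e2.
subst a' b' c' d'.
case: H H' => -[m [h1 [h2 [h3 [E ->]]]]] [] [m' [k1 [k2 [k3 [E' ->]]]]].
- have mm : m = m' by apply: (@pcat_inj b _ _ h1 k1); rewrite -E -E'.
  by subst m'; apply: gpair_eq => //; apply: fpath_eq.
- have [m0 m0'] := pcat_pcat_nil E E'.
  by apply: gpair_eq; rewrite pcat_nil.
- have [m0' m0] := pcat_pcat_nil E' E.
  by apply: gpair_eq; rewrite pcat_nil.
- have mm : m = m' by apply: (@pcat_inj c _ _ h1 k1); rewrite -E -E'.
  by subst m'; apply: gpair_eq => //; apply: fpath_eq.
Qed.

Lemma gmulE x y z : gmul_spec x y z -> gmul x y = z.
Proof.
rewrite /gmul => h; case: pselect => [k|[]]; last by exists z.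
by case: cid => z' /= /gmul_spec_fun; apply.
Qed.

Lemma gmul_eq0 x y : ~ (exists z, gmul_spec x y z) -> gmul x y = gzero.
Proof. by rewrite /gmul; case: pselect. Qed.

Definition idem : set gamma := [set p | gmul p p = p].

Lemma idemP p : idem p <-> p = gzero \/ exists a, p = @gpair a a erefl.
Proof.
split.
- case: p => [|a b ab pp]; [by left | right].
  have h : gmul_spec (gpair ab) (gpair ab) (gpair ab).
    case: (pselect (exists z, gmul_spec (gpair ab) (gpair ab) z)) => [[z hz]|nk].
      by have := hz; rewrite -(gmulE hz) pp.
    by move: pp; rewrite /idem /= gmul_eq0.
  case/gmul_spec_pair: h => a' [b' [c [d [ab' [cd [e1 e2 H]]]]]].
  have [? ?] := gpair_inj e1; have [? ?] := gpair_inj e2; subst a' b' c d.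
  suff e : a = b by exists a; apply: gpair_eq.
  case: H => -[m [h1 [h2 [h3 [E /gpair_inj[E1 E2]]]]]].
  + have m0 : pedges m = [::].
      by have [] := @pcat_pcat_nil a m a m h2 h2 E1 E1.
    by rewrite E pcat_nil.
  + have m0 : pedges m = [::].
      by have [] := @pcat_pcat_nil b m b m h2 h2 E2 E2.
    by rewrite E pcat_nil.
- case=> [->|[a ->]]; first by apply: gmul_eq0 => -[z /gmul_spec_pair
    [a [b [c [d [ab [cd []]]]]]]].
  pose v := @FPath (prng a) [::] I.
  have av : prng a = psrc v by [].
  have avE : pcat av = a by rewrite pcat_nil.
  apply: gmulE.
  have avr : prng (pcat av) = prng a by rewrite avE.
  have -> : @gpair a a erefl = @gpair (pcat av) a avr by apply: gpair_eq.
  have {1}-> : @gpair (pcat av) a avr = @gpair a a erefl by apply: gpair_eq.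
  exact: GmulL.
Qed.

Definition gprec (x y : gamma) : Prop := gmul x (ginv y) = gmul x (ginv x).

Definition glt (x : gamma) (n : nat) (xs : 'I_n.+1 -> gamma) : Prop :=
  forall y, gprec y x -> y <> gzero ->
  exists z j, [/\ z <> gzero, gprec z y & gprec z (xs j)].

Definition lt_closed (I : set gamma) : Prop :=
  forall p, idem p ->
  forall (n : nat) (ps : 'I_n.+1 -> gamma),
    (forall i, I (ps i)) -> glt p ps -> I p.

Definition invariant (I : set gamma) : Prop :=
  forall p x, I p -> gprec p (gmul (ginv x) x) ->
  I (gmul (gmul x p) (ginv x)).

Definition closed_invariant : set (set gamma) :=
  [set I | [/\ I `<=` idem, I !=set0, lt_closed I & invariant I]].

Definition closed_join (I J : set gamma) : set gamma :=
  [set p | idem p /\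
    exists (n : nat) (ps : 'I_n.+1 -> gamma),
      (forall i, (I `|` J) (ps i)) /\ glt p ps].

Definition reaches (v w : vertex g) : Prop :=
  exists a : fpath, psrc a = v /\ prng a = w.

Definition hereditary (H : set (vertex g)) : Prop :=
  forall v w, H v -> reaches v w -> H w.

Definition saturated (H : set (vertex g)) : Prop :=
  forall v, (forall e, src e = v -> H (rng e)) -> H v.

Definition hereditary_saturated : set (set (vertex g)) :=
  [set H | hereditary H /\ saturated H].

Definition saturated_join (H K : set (vertex g)) : set (vertex g) :=
  smallest saturated (H `|` K).

(* r(p); it is used on nonzero idempotents (a, a) only. *)
Definition grng (p : gamma) : option (vertex g) :=
  if p is gpair a _ _ then Some (prng a) else None.

Definition range_set (I : set gamma) : set (vertex g) :=
  [set v | exists p, [/\ I p, p <> gzero & grng p = Some v]].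

Definition idem_set (H : set (vertex g)) : set gamma :=
  [set p | [/\ idem p, p <> gzero & exists2 v, H v & grng p = Some v]]
  `|` [set gzero].

End Paths.

Arguments gzero {g}.

(* C, ordered by inclusion, is a lattice with the given meet and join. *)
Definition is_set_lattice (T : Type) (C : set (set T))
    (meet join : set T -> set T -> set T) : Prop :=
  forall A B, C A -> C B ->
  [/\ C (meet A B),
      forall D, C D -> (D `<=` meet A B <-> D `<=` A /\ D `<=` B),
      C (join A B) &
      forall D, C D -> (join A B `<=` D <-> A `<=` D /\ B `<=` D)].

(* f restricts to a bijection from C onto D, with inverse h, that preserves
   meets and joins. *)
Definition is_lattice_iso (T U : Type)
    (C : set (set T)) (meetC joinC : set T -> set T -> set T)
    (D : set (set U)) (meetD joinD : set U -> set U -> set U)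
    (f : set T -> set U) (h : set U -> set T) : Prop :=
  [/\ forall A, C A -> D (f A) /\ h (f A) = A,
      forall B, D B -> C (h B) /\ f (h B) = B,
      forall A A', C A -> C A' -> f (meetC A A') = meetD (f A) (f A') &
      forall A A', C A -> C A' -> f (joinC A A') = joinD (f A) (f A')].

(* Main.v *)
Require Import Defs.
From mathcomp Require Import all_boot.
From mathcomp Require Import boolp classical_sets cardinality.

(* For nonzero idempotents, (c, c) precedes (a, a) exactly when the path c
   extends a, so (a, a) < ((a_1, a_1), ..., (a_n, a_n)) says that every
   extension of a is comparable with some a_j.  By invariance, membership of
   (a, a) in I depends only on r(a), and closedness under < then translates into
   saturation of the set of ranges: (a, a) is covered by the finitely many
   one-edge extensions of a, and conversely, if r(a) lies outside a saturated
   set H, then a has arbitrarily long extensions ending outside H, which no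
   finite family of paths ending in a hereditary H can cover. *)

Local Open Scope classical_set_scope.

Section Idempotents.
Set Implicit Arguments.
Unset Strict Implicit.
Variable g : digraph.
Implicit Types (a b c d : Defs.fpath g) (x y z p : gamma g).
Implicit Types (F P Q : set (Defs.fpath g)) (H K : set (vertex g)).

(** * The prefix order on finite paths *)

Definition ext a c :=
  psrc a = psrc c /\ exists l, pedges c = pedges a ++ l.

Lemma ext_refl a : ext a a.
Proof. by split=> //; exists [::]; rewrite cats0. Qed.

Lemma ext_trans b a c : ext a b -> ext b c -> ext a c.
Proof.
move=> [ab [l bE]] [bc [l' cE]]; split; first by rewrite ab.
by exists (l ++ l'); rewrite cE bE catA.
Qed.

Lemma ext_pcat a m (am : prng a = psrc m) : ext a (pcat am).
Proof. by split=> //; exists (pedges m). Qed.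

Lemma extP a c :
  ext a c <-> exists m (am : prng a = psrc m), c = pcat am.
Proof.
split=> [[acs [l cE]]|[m [am ->]]]; last exact: ext_pcat.
have ch : is_chain (prng a) l.
  by have := pchain c; rewrite cE -acs => /is_chain_cat[].
by exists (FPath ch), erefl; apply: fpath_eq.
Qed.

(** Both paths are truncations of the edge list of [c], so the one cut earlier is a truncation of
    the other. *)
Lemma ext_linear a b c : ext a c -> ext b c ->
  (size (pedges a) <= size (pedges b))%N -> ext a b.
Proof.
move=> [ac [l cE]] [bc [l' cE']] ab; split; first by rewrite ac bc.
exists (drop (size (pedges a)) (pedges b)).
have -> : pedges a = take (size (pedges a)) (pedges b).
  have aE : pedges a = take (size (pedges a)) (pedges c).
    by rewrite cE take_size_cat.
  rewrite [LHS]aE cE' take_cat; case: ltnP => // ba.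
  have -> : size (pedges a) = size (pedges b) by apply/eqP; rewrite eqn_leq ab.
  by rewrite subnn take0 cats0 take_size.
by rewrite size_takel // cat_take_drop.
Qed.

Lemma reaches_ext a c : ext a c -> reaches (prng a) (prng c).
Proof. by move=> /extP[m [am ->]]; exists m; rewrite prng_pcat. Qed.

Definition vpath (v : vertex g) : Defs.fpath g := @FPath g v [::] I.

Definition epath (e : edge g) : Defs.fpath g :=
  @FPath g (src e) [:: e] (conj erefl I).

(* Junk value a when the source of e is not the range of a. *)
Definition snoc a (e : edge g) : Defs.fpath g :=
  if pselect (prng a = psrc (epath e)) is left ae then pcat ae else a.

Lemma snocE a e : src e = prng a ->
  psrc (snoc a e) = psrc a /\ pedges (snoc a e) = rcons (pedges a) e.
Proof.
by rewrite /snoc => /esym ae; case: pselect => // h; rewrite -cats1.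
Qed.

Lemma ext_snoc a e : src e = prng a -> ext a (snoc a e).
Proof.
by move=> /snocE[s m]; split=> //; exists [:: e]; rewrite m cats1.
Qed.

Lemma prng_snoc a e : src e = prng a -> prng (snoc a e) = rng e.
Proof. by move=> /snocE[_ m]; rewrite /prng m map_rcons last_rcons. Qed.

(* Path form of the relation p < (p_1, ..., p_n) for nonzero idempotents. *)
Definition cover a F :=
  forall c, ext a c -> exists d b, [/\ ext c d, F b & ext b d].

(** * A closure operator on sets of paths *)

(** Finiteness of [F] mirrors the finite families in [<]. An empty [F] covers nothing, since [a]
    extends itself, which matches families having at least one member. *)
Definition span P : set (Defs.fpath g) :=
  [set a | exists F, [/\ finite_set F, F `<=` P & cover a F]].

Lemma span_ext P a b : P b -> ext b a -> span P a.
Proof.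
move=> Pb ba; exists [set b]; split; [exact: finite_set1|by move=> _ ->|].
move=> c ac; exists c, b; split=> //; first exact: ext_refl.
exact: ext_trans ba ac.
Qed.

(** Each member of a finite cover is replaced by a finite cover of its own, and the union stays
    finite. *)
Lemma span_trans P : span (span P) `<=` span P.
Proof.
move=> a [F [finF FP aF]].
have /choice[G GP] b : exists G, F b ->
    [/\ finite_set G, G `<=` P & cover b G].
  have [/FP[G hG]|nFb] := EM (F b); first by exists G.
  by exists set0.
exists (\bigcup_(b in F) G b); split.
- by apply: bigcup_finite => // b /GP[].
- by apply: bigcup_sub => b /GP[].
move=> c /aF[d [b [cd Fb bd]]].
have [_ _ /(_ _ bd)[d' [b' [dd' Gb' b'd']]]] := GP _ Fb.
exists d', b'; split=> //; first exact: ext_trans cd dd'.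
by exists b.
Qed.

Lemma span_mono P Q : P `<=` Q -> span P `<=` span Q.
Proof.
by move=> PQ a [F [finF FP aF]]; exists F; split=> //; apply: subset_trans PQ.
Qed.

(** An extension of [a] either is [a] itself, and then some edge prolongs it, or continues along one
    of the finitely many edges leaving [prng a]. *)
Lemma span_snoc (s_nonempty : forall v, (@src g) @^-1` [set v] !=set0)
    (s_finite : forall v, finite_set ((@src g) @^-1` [set v])) P a :
  (forall e, src e = prng a -> P (snoc a e)) -> span P a.
Proof.
move=> aP; exists (snoc a @` ((@src g) @^-1` [set prng a])); split.
- exact/finite_image/s_finite.
- by move=> _ [e ea <-]; apply: aP.
move=> c [ac [[|e l] cE]].
  have [e ea] := s_nonempty (prng a).
  have -> : c = a by apply: fpath_eq; rewrite // cE cats0.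
  exists (snoc a e), (snoc a e); split; last exact: ext_refl.
    exact: ext_snoc.
  by exists e.
have ea : src e = prng a.
  by have := pchain c; rewrite cE -ac => /is_chain_cat[_ []].
exists c, (snoc a e); split; [exact: ext_refl|by exists e|].
have [sE mE] := snocE ea.
by split; [rewrite sE|exists l; rewrite mE cE cat_rcons].
Qed.

(** * Escaping from saturated sets *)

(** A vertex outside a saturated set emits an edge whose range is again outside; following such
    edges gives any length. *)
Lemma saturated_escape H a n : saturated H -> ~ H (prng a) ->
  exists c, [/\ ext a c, (n <= size (pedges c))%N & ~ H (prng c)].
Proof.
move=> satH aH; elim: n => [|n [c [ac nc cH]]].
  by exists a; split=> //; apply: ext_refl.
have /existsNP[e /not_implyP[ec eH]] : ~ forall e, src e = prng c -> H (rng e).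
  by move=> h; apply: cH; apply: satH.
exists (snoc c e); split; last by rewrite prng_snoc.
  exact/(ext_trans ac)/ext_snoc.
by have [_ ->] := snocE ec; rewrite size_rcons.
Qed.

Lemma finite_size_bound F : finite_set F ->
  exists N, forall b, F b -> (size (pedges b) <= N)%N.
Proof.
move=> finF.
have /finite_seqP[s sE] := finite_image (fun b => size (pedges b)) finF.
(* The sum of all the lengths bounds each of them. *)
exists (sumn s) => b Fb.
have : size (pedges b) \in s.
  by move/seteqP: sE => [+ _]; apply; exists b.
move=> /(perm_to_rem) /perm_sumn -> /=; exact: leq_addr.
Qed.

Lemma span_hereditary_saturated H a : hereditary H -> saturated H ->
  span (@prng g @^-1` H) a -> H (prng a).
Proof.
move=> herH satH [F [finF FH aF]]; apply: contrapT => aH.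
(* Once [c] is at least as long as every path of [F], the covering path [b] must be a prefix of [c],
   and heredity puts [prng c] in [H]. *)
have [N FN] := finite_size_bound finF.
have [c [ac Nc cH]] := saturated_escape N satH aH.
have [d [b [cd Fb bd]]] := aF _ ac.
apply/cH/(herH (prng b)); first exact: FH.
by apply/reaches_ext/(ext_linear bd cd)/(leq_trans _ Nc)/FN.
Qed.

(** * Products and the natural order below idempotents *)

Definition diag a : gamma g := @gpair g a a erefl.

Lemma diag_inj : injective diag.
Proof. by move=> a b /gpair_inj[]. Qed.

Lemma idem_diag a : idem (diag a).
Proof. by apply/idemP; right; exists a. Qed.

Lemma gmul0l x : gmul gzero x = gzero.
Proof.
apply: gmul_eq0 => -[z /gmul_spec_pair].
by move=> [a [b [c [d [ab [cd [+ _ _]]]]]]].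
Qed.

Lemma gmul0r x : gmul x gzero = gzero.
Proof.
apply: gmul_eq0 => -[z /gmul_spec_pair].
by move=> [a [b [c [d [ab [cd [_ + _]]]]]]].
Qed.

Lemma gmul_extl a b m d (ab : prng a = prng b) (bm : prng b = psrc m)
    (am : prng a = psrc m) (bmd : prng (pcat bm) = prng d)
    (amd : prng (pcat am) = prng d) :
  gmul (gpair ab) (gpair bmd) = gpair amd.
Proof. exact/gmulE/GmulL. Qed.

Lemma gmul_extr a c m d (cm : prng c = psrc m) (acm : prng a = prng (pcat cm))
    (cd : prng c = prng d) (dm : prng d = psrc m)
    (adm : prng a = prng (pcat dm)) :
  gmul (gpair acm) (gpair cd) = gpair adm.
Proof. exact/gmulE/GmulR. Qed.

Lemma gmul_pair a b d (ab : prng a = prng b) (bd : prng b = prng d)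
    (ad : prng a = prng d) : gmul (gpair ab) (gpair bd) = gpair ad.
Proof.
(* Appending a path of length 0 brings the factors into the shape of the product rule. *)
pose v := vpath (prng b).
have bv : prng b = psrc v by [].
have av : prng a = psrc v by [].
have bE : pcat bv = b by rewrite pcat_nil.
have aE : pcat av = a by rewrite pcat_nil.
have bvd : prng (pcat bv) = prng d by rewrite bE.
have avd : prng (pcat av) = prng d by rewrite aE.
rewrite -(gpair_eq avd ad aE erefl) -(gpair_eq bvd bd bE erefl).
exact: gmul_extl.
Qed.

Lemma gmulV a b (ab : prng a = prng b) :
  gmul (gpair ab) (ginv (gpair ab)) = diag a.
Proof. exact: gmul_pair. Qed.

Lemma gmulVl a b (ab : prng a = prng b) :
  gmul (ginv (gpair ab)) (gpair ab) = diag b.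
Proof. exact: gmul_pair. Qed.

Lemma gprec_diag y a :
  gprec y (diag a) <-> y = gzero \/ exists2 c, ext a c & y = diag c.
Proof.
split=> [|[->|[c /extP[m [am ->]] ->]]]; last 2 first.
- by rewrite /gprec !gmul0l.
- by rewrite /gprec gmulV; apply: gmul_extr.
case: y => [|c d cd]; first by left.
rewrite /gprec gmulV => cda; right.
have /gmul_spec_pair : gmul_spec (gpair cd) (diag a) (diag c).
  have [[z zP]|nz] :=
    EM (exists z, gmul_spec (gpair cd) (ginv (diag a)) z).
    by have := zP; rewrite -(gmulE zP) cda.
  by move: cda; rewrite gmul_eq0.
move=> [c' [d' [a' [a'' [cd' [aa [e1 e2 +]]]]]]].
have [? ?] := gpair_inj e1; have [? ?] := gpair_inj e2; subst c' d' a' a''.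
(* In the first case [c] equals [c] followed by [m], so [m] has length 0; in the second, [c] and [d]
   are both [a] followed by [m]. *)
case=> -[m [h1 [h2 [h3 [E /gpair_inj[E1 E2]]]]]].
  have m0 : pedges m = [::] by have [] := @pcat_pcat_nil _ c m c m h2 h2 E1 E1.
  have ad : a = d by rewrite E pcat_nil.
  exists c; first by rewrite E2; apply: ext_refl.
  by apply: gpair_eq => //; rewrite -ad.
have dc : d = c.
  by rewrite E E2; apply: fpath_eq.
exists c; first by rewrite E2; apply: ext_pcat.
exact: gpair_eq.
Qed.

Lemma gprec0 y : gprec y gzero -> y = gzero.
Proof. by case: y => // a b ab; rewrite /gprec gmulV /= gmul0r. Qed.

Lemma glt_zero n (ps : 'I_n.+1 -> gamma g) : glt gzero ps.
Proof. by move=> y /gprec0. Qed.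

(** Carries [<] over to paths: zero members of a family cover nothing, and the nonzero elements
    below [diag a] are the [diag c] with [c] extending [a]. *)
Lemma glt_span (X : set (gamma g)) a : X `<=` @idem g -> X gzero ->
  (exists n (ps : 'I_n.+1 -> gamma g), (forall i, X (ps i)) /\ glt (diag a) ps)
  <-> span (diag @^-1` X) a.
Proof.
move=> Xidem X0; split=> [[n [ps [psX aps]]]|[F [finF FX aF]]].
  exists [set b | exists i, ps i = diag b]; split.
  (* Each member of the family determines at most one path, with default [a] for zero, so the paths
     are among finitely many values. *)
  - have /choice[f fE] i : exists b, forall b', ps i = diag b' -> b' = b.
      have /idemP[->|[b ->]] := Xidem _ (psX i); first by exists a.
      by exists b => b' /diag_inj.
    apply: (@sub_finite_set _ _ (range f)).
      by move=> b [i /fE->]; exists i.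
    exact/finite_image/finite_finset.
  - by move=> b [i iE]; rewrite /= -iE.
  move=> c ac; have [||z [j [z0 zc zj]]] := aps (diag c) => //.
    by apply/gprec_diag; right; exists c.
  have /gprec_diag[//|[d cd zE]] := zc; subst z.
  have /idemP[jE|[b jE]] := Xidem _ (psX j).
    by rewrite jE in zj; have := gprec0 zj.
  rewrite jE in zj; have /gprec_diag[//|[d' bd' /diag_inj dd']] := zj.
  by exists d, b; split=> //; [exists j|rewrite dd'].
have /(@finite_seqP {classic gamma g})[s sE] := finite_image diag finF.
have sP z : (z \in s) <-> (diag @` F) z by rewrite sE.
(* Padding with a final [gzero], which lies in [X], gives a nonempty family even when [s] is
   empty. *)
exists (size s), (fun i => nth gzero s i); split=> [i|y].
  have [si|si] := leqP (size s) i; first by rewrite nth_default.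
  by have /sP[b Fb <-] := mem_nth (gzero : {classic gamma g}) si; apply: FX.
move=> /gprec_diag[-> //|[c ac ->] _].
have [d [b [cd Fb bd]]] := aF c ac.
have bs : diag b \in s by apply/sP; exists b.
have bs' : (index (diag b : {classic gamma g}) s < (size s).+1)%N.
  exact: index_size.
exists (diag d), (Ordinal bs'); split=> //=.
  by apply/gprec_diag; right; exists d.
rewrite (nth_index (gzero : {classic gamma g}) bs).
by apply/gprec_diag; right; exists d.
Qed.

(** * Closed invariant sets and their ranges *)

Lemma closed_invariant0 (I : set (gamma g)) : closed_invariant I -> I gzero.
Proof.
case=> _ [p Ip] ltI _.
by apply: (ltI _ _ 0%N (fun=> p)) => //; [apply/idemP; left|apply: glt_zero].
Qed.

Lemma closed_invariant_span (I : set (gamma g)) a : closed_invariant I ->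
  span (diag @^-1` I) a -> I (diag a).
Proof.
move=> CI; have I0 := closed_invariant0 CI; case: CI => [Iidem _ ltI _].
move=> /(glt_span _ Iidem I0)[n [ps [psI aps]]].
by apply: ltI psI aps; apply: idem_diag.
Qed.

(** Conjugating [diag a] by the pair [(b, a)] yields [diag b]. *)
Lemma closed_invariant_prng (I : set (gamma g)) a b : closed_invariant I ->
  prng a = prng b -> I (diag a) -> I (diag b).
Proof.
case=> _ _ _ invI ab Ia.
have ba := esym ab.
have := invI (diag a) (gpair ba) Ia.
rewrite gmulVl gmul_pair [ginv _]/= gmul_pair; apply.
by apply/gprec_diag; right; exists a => //; apply: ext_refl.
Qed.

Lemma range_setP (I : set (gamma g)) a : closed_invariant I ->
  range_set I (prng a) <-> I (diag a).
Proof.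
move=> CI; split=> [[p [Ip p0 pa]]|Ia]; last by exists (diag a).
have [Iidem _ _ _] := CI.
have /idemP[//|[b pE]] := Iidem _ Ip; subst p.
by case: pa => pa; apply: closed_invariant_prng Ip.
Qed.

Lemma idem_setP H a : idem_set H (diag a) <-> H (prng a).
Proof.
split=> [[[_ _ [v Hv [vE]]]|//]|Ha]; first by rewrite vE.
by left; split=> //; [apply: idem_diag|exists (prng a)].
Qed.

Lemma idem_set_idem H : idem_set H `<=` @idem g.
Proof. by move=> p [[]//|->]; apply/idemP; left. Qed.

Lemma idem_set0 H : idem_set H gzero.
Proof. by right. Qed.

Lemma eq_idem (I J : set (gamma g)) : I `<=` @idem g -> J `<=` @idem g ->
  I gzero -> J gzero -> (forall a, I (diag a) <-> J (diag a)) -> I = J.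
Proof.
move=> Iidem Jidem I0 J0 IJ; apply/seteqP; split=> p.
  by move=> Ip; have /idemP[->//|[a pE]] := Iidem _ Ip; subst p; apply/IJ.
by move=> Ip; have /idemP[->//|[a pE]] := Jidem _ Ip; subst p; apply/IJ.
Qed.

Lemma idem_set_closed_invariant H :
  hereditary_saturated H -> closed_invariant (idem_set H).
Proof.
move=> [herH satH]; split.
- exact: idem_set_idem.
- by exists gzero; apply: idem_set0.
- move=> p /idemP[->|[a ->]] n ps psH; first by move=> _; apply: idem_set0.
  move=> aps; apply/idem_setP/(span_hereditary_saturated herH satH).
  have /(glt_span a (@idem_set_idem H) (idem_set0 H)) :
      exists n (ps : 'I_n.+1 -> gamma g),
      (forall i, idem_set H (ps i)) /\ glt (diag a) ps by exists n, ps.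
  by apply: span_mono => b /idem_setP.
move=> p [|c d cd] Hp; first by rewrite !gmul0l => _; apply: idem_set0.
rewrite gmulVl => /gprec_diag[->|[a /extP[m [dm ->]] pE]].
  by rewrite gmul0r gmul0l; apply: idem_set0.
subst p; move/idem_setP: Hp => Hp.
(* Here [p] was [(dm, dm)]; conjugation by [(c, d)] turns it into [(cm, cm)], which has the same
   range. *)
have cm : prng c = psrc m by rewrite cd.
have cmdm : prng (pcat cm) = prng (pcat dm) by rewrite !prng_pcat.
rewrite /diag (gmul_extl cd erefl cmdm).
rewrite [ginv _]/= (gmul_extr cmdm (esym cd) (erefl (prng (pcat cm)))).
by apply/idem_setP; rewrite prng_pcat; rewrite prng_pcat in Hp.
Qed.

Lemma idem_setK H : range_set (idem_set H) = H.
Proof.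
apply/seteqP; split=> v.
  by case=> p [[[_ _ [w Hw pw]]|->//] _ pv]; move: pw; rewrite pv => -[->].
move=> Hv; exists (diag (vpath v)); split=> //.
exact/idem_setP.
Qed.

Lemma range_setK (I : set (gamma g)) :
  closed_invariant I -> idem_set (range_set I) = I.
Proof.
move=> CI; apply: eq_idem.
- exact: idem_set_idem.
- by case: CI.
- exact: idem_set0.
- exact: closed_invariant0.
by move=> a; rewrite idem_setP range_setP.
Qed.

(** * Order, meets and joins of vertex sets *)

Lemma idem_set_le H K : (idem_set H `<=` idem_set K) <-> (H `<=` K).
Proof.
split=> [HK v Hv|HK p [[ip p0 [v /HK Kv pv]]|->]]; [|left|right] => //.
  by apply/(idem_setP K (vpath v))/HK/idem_setP.
by split=> //; exists v.
Qed.

Lemma idem_setI H K : idem_set (H `&` K) = idem_set H `&` idem_set K.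
Proof.
apply: eq_idem.
- exact: idem_set_idem.
- by move=> p [/idem_set_idem].
- exact: idem_set0.
- by split; apply: idem_set0.
by move=> a; split=> [/idem_setP[Ha Ka]|[/idem_setP ? /idem_setP ?]];
  [split|]; apply/idem_setP.
Qed.

Lemma hereditary_saturatedI H K : hereditary_saturated H ->
  hereditary_saturated K -> hereditary_saturated (H `&` K).
Proof.
move=> [herH satH] [herK satK]; split.
  by move=> v w [Hv Kv] vw; split; [apply: herH vw|apply: herK vw].
by move=> v vHK; split; [apply: satH|apply: satK] => e /vHK[].
Qed.

(* The vertices all of whose descendants lie in the saturation form a
   saturated set. *)
Lemma saturated_join_hereditary_saturated H K : hereditary H -> hereditary K ->
  hereditary_saturated (saturated_join H K).
Proof.
move=> herH herK; set S := saturated_join H K.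
have satS : saturated S.
  by move=> v vS A [satA HKA]; apply: (satA) => e ev; apply: (vS e ev A).
split=> // v w Sv; move: v Sv w.
apply: (@smallest_sub _ _ _ [set v | forall w, reaches v w -> S w]).
  (* The path of length 0 is handled by saturation of [S]; any other path continues from the range
     of its first edge. *)
  move=> v vT w [[u [|e l] ch] [/= uv <-]]; subst u.
    apply: satS => e ev; apply: (vT e ev).
    by exists (vpath (rng e)).
  case: (ch) => ev el.
  by apply: (vT e) => //; exists (FPath el).
move=> v vHK w vw; apply: sub_gen_smallest.
by case: vHK => h; [left; apply: herH vw|right; apply: herK vw].
Qed.

Lemma saturated_join_le H K (L : set (vertex g)) : saturated L ->
  (saturated_join H K `<=` L) <-> (H `<=` L /\ K `<=` L).
Proof.
move=> satL; rewrite -subUset; split=> [|HKL]; last exact: smallest_sub.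
by apply: subset_trans; apply: sub_gen_smallest.
Qed.

End Idempotents.

(** * Graphs whose vertices emit finitely many edges, and at least one *)

Section FinitelyManyEdges.
Set Implicit Arguments.
Unset Strict Implicit.
Variable g : digraph.
Hypothesis s_nonempty : forall v : vertex g, (@src g) @^-1` [set v] !=set0.
Hypothesis s_finite : forall v : vertex g, finite_set ((@src g) @^-1` [set v]).

(** A path covers each of its extensions, which gives heredity; it is covered by its one-edge
    extensions, which gives saturation. *)
Lemma range_set_hereditary_saturated (I : set (gamma g)) :
  closed_invariant I -> hereditary_saturated (range_set I).
Proof.
move=> CI; split.
  move=> v _ Iv [m [mv <-]].
  apply/(range_setP _ CI)/(closed_invariant_span CI)/(@span_ext _ _ _ (vpath v)).
    exact/(range_setP (vpath v) CI).
  by split=> //=; exists (pedges m).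
move=> v vI; apply/(range_setP (vpath v) CI)/(closed_invariant_span CI).
apply: span_snoc => // e ev.
by apply/(range_setP _ CI); rewrite prng_snoc //; apply: vI.
Qed.

Lemma closed_join_idem_set (H K : set (vertex g)) :
  hereditary_saturated H -> hereditary_saturated K ->
  closed_join (idem_set H) (idem_set K) = idem_set (saturated_join H K).
Proof.
move=> HH KK; have [herH satH] := HH; have [herK satK] := KK.
have [herS satS] := saturated_join_hereditary_saturated herH herK.
set X := idem_set H `|` idem_set K.
have Xidem : X `<=` @idem g by move=> p [] /idem_set_idem.
have X0 : X gzero by left; apply: idem_set0.
have XP a : X (diag a) <-> (H `|` K) (prng a).
  by rewrite /X /setU /= !idem_setP.
apply: eq_idem.
- by move=> p [].
- exact: idem_set_idem.
- split; first by apply/idemP; left.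
  by exists 0%N, (fun=> gzero); split=> //; apply: glt_zero.
- exact: idem_set0.
move=> a; rewrite idem_setP; split=> [[_ /(glt_span _ Xidem X0) aX]|].
  apply: (span_hereditary_saturated herS satS); apply: span_mono aX => b.
  by move=> /XP; apply: sub_gen_smallest.
move=> Sa; split; first exact: idem_diag.
apply/(glt_span _ Xidem X0).
(* [T] contains [H] and [K], and it is saturated by [span_snoc] and [span_trans], so it contains the
   smallest such set. *)
pose T := [set v | forall b : Defs.fpath g, prng b = v -> span (@diag g @^-1` X) b].
suff ST : saturated_join H K `<=` T by apply: (ST _ Sa).
apply: smallest_sub => [v vT b bv|v HKv b bv].
  apply/span_trans/span_snoc => // e eb.
  by apply: (vT e); rewrite ?eb // prng_snoc.
by apply: (@span_ext _ _ _ b); [apply/XP; rewrite bv|apply: ext_refl].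
Qed.

End FinitelyManyEdges.

Theorem lemma8p3 (g : digraph)
    (r_onto : range (@rng g) = [set: vertex g])
    (s_nonempty : forall v : vertex g, (@src g) @^-1` [set v] !=set0)
    (s_finite : forall v : vertex g, finite_set ((@src g) @^-1` [set v])) :
  [/\ is_set_lattice (@closed_invariant g) (@setI (gamma g)) (@closed_join g),
      is_set_lattice (@hereditary_saturated g)
        (@setI (vertex g)) (@saturated_join g) &
      is_lattice_iso
        (@closed_invariant g) (@setI (gamma g)) (@closed_join g)
        (@hereditary_saturated g) (@setI (vertex g)) (@saturated_join g)
        (@range_set g) (@idem_set g)].
Proof.
have rP := range_set_hereditary_saturated s_nonempty s_finite.
have iP := @idem_set_closed_invariant g.
have jP (H K : set (vertex g)) :
    hereditary_saturated H -> hereditary_saturated K ->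
    hereditary_saturated (saturated_join H K).
  by move=> [hH _] [hK _]; apply: saturated_join_hereditary_saturated.
have jE := closed_join_idem_set s_nonempty s_finite.
split.
(* Writing closed invariant sets as [idem_set] of their ranges reduces the lattice laws to those of
   vertex sets. *)
- move=> A B CA CB; rewrite -(range_setK CA) -(range_setK CB).
  have HA := rP _ CA; have HB := rP _ CB.
  rewrite jE // -idem_setI; split.
  + exact/iP/hereditary_saturatedI.
  + by move=> D _; rewrite idem_setI subsetI.
  + exact/iP/jP.
  move=> D CD; rewrite -(range_setK CD) !idem_set_le.
  by apply: saturated_join_le; have [] := rP _ CD.
- move=> A B HA HB; split.
  + exact: hereditary_saturatedI.
  + by move=> D _; rewrite subsetI.
  + exact: jP.
  by move=> D [_ satD]; apply: saturated_join_le.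
split=> [A CA|B HB|A A' CA CA'|A A' CA CA'].
- by split; [apply: rP|apply: range_setK].
- by split; [apply: iP|apply: idem_setK].
- rewrite -{1}(range_setK CA) -{1}(range_setK CA') -idem_setI.
  exact: idem_setK.
- rewrite -{1}(range_setK CA) -{1}(range_setK CA').
  by rewrite jE ?idem_setK //; apply: rP.
Qed.
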